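(* Let $(G,i)$ be a filter pair over the signature $\Sigma$ and $A$ a $\Sigma$-structure. For $\Gamma\cup\{\varphi\}\subseteq A$ define $$\Gamma\vdash_G^A\varphi\quad\text{iff}\quad\text{for every }a\in G(A),\ \Gamma\subseteq i_A(a)\text{ implies }\varphi\in i_A(a).$$ Then $(A,\vdash_G^A)$ is an abstract logic, i.e. $\vdash_G^A$ is a Tarskian consequence relation on $A$.
   Context: $\Sigma$-Str is the category of $\Sigma$-structures and homomorphisms. $AL$ is the category of algebraic lattices with maps preserving arbitrary meets and directed joins. A filter pair over $\Sigma$ is a pair $(G,i)$ of a contravariant functor $G:\Sigma\text{-Str}\to AL$ and maps $i_A:G(A)\to(\mathcal{P}(A),\subseteq)$, one for each $\Sigma$-structure $A$, preserving arbitrary infima (in particular $i_A(\top)=A$) and directed suprema, such that $i_A\circ G(h)=h^{-1}\circ i_B$ for every homomorphism $h:A\to B$. A Tarskian consequence relation on a $\Sigma$-structure $A$ is a relation $\vdash\subseteq\mathcal{P}(A)\times A$ such that: (reflexivity) $\varphi\in\Gamma$ implies $\Gamma\vdash\varphi$; (cut) if $\Gamma\vdash\varphi$ and $\Delta\vdash\psi$ for every $\psi\in\Gamma$, then $\Delta\vdash\varphi$; (monotonicity) if $\Gamma\subseteq\Delta$ and $\Gamma\vdash\varphi$ then $\Delta\vdash\varphi$; (finitarity) if $\Gamma\vdash\varphi$ then $\Delta\vdash\varphi$ for some finite $\Delta\subseteq\Gamma$; (structurality) if $\Gamma\vdash\varphi$ and $\sigma$ is an endomorphism of $A$, then $\sigma[\Gamma]\vdash\sigma(\varphi)$.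 An abstract logic is a pair of a $\Sigma$-structure and a Tarskian consequence relation on it. *)

(* Defs.v *)
From HB Require Import structures.
From mathcomp Require Import all_boot all_order.
From mathcomp Require Import boolp classical_sets functions cardinality.

Set Implicit Arguments.
Unset Strict Implicit.
Unset Printing Implicit Defensive.

Local Open Scope classical_set_scope.

(* [fsym n] and [rsym n] are the function and relation symbols of arity [n].
   A purely algebraic signature is one with [rsym n] empty for every [n]. *)
Record signature := Signature {
  fsym : nat -> Type;
  rsym : nat -> Type
}.

Record sigma_str (Sg : signature) := SigmaStr {
  carrier :> Type;
  finterp : forall n, fsym Sg n -> n.-tuple carrier -> carrier;
  rinterp : forall n, rsym Sg n -> n.-tuple carrier -> Prop
}.

Record hom (Sg : signature) (A B : sigma_str Sg) := Hom {
  hom_fun :> A -> B;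
  hom_fsym : forall n (f : fsym Sg n) (t : n.-tuple A),
    hom_fun (finterp f t) = finterp f (map_tuple hom_fun t);
  hom_rsym : forall n (r : rsym Sg n) (t : n.-tuple A),
    rinterp r t -> rinterp r (map_tuple hom_fun t)
}.

Lemma map_tuple_id n (T : Type) (t : n.-tuple T) : map_tuple id t = t.
Proof. by apply: val_inj; rewrite /= map_id. Qed.

Lemma map_tuple_comp n (T U V : Type) (g : U -> V) (f : T -> U)
  (t : n.-tuple T) : map_tuple (g \o f) t = map_tuple g (map_tuple f t).
Proof. by apply: val_inj; rewrite /= map_comp. Qed.

Definition hom_id (Sg : signature) (A : sigma_str Sg) : hom A A.
Proof.
exists id => [n f t|n r t]; by rewrite map_tuple_id.
Defined.

Definition hom_comp (Sg : signature) (A B C : sigma_str Sg)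
  (g : hom B C) (f : hom A B) : hom A C.
Proof.
exists (g \o f) => [n s t|n r t rt]; rewrite map_tuple_comp.
- by rewrite /= !hom_fsym.
- by do 2!apply: hom_rsym.
Defined.

Section Posets.
Context {d d' : Order.disp_t} {L : porderType d} {M : porderType d'}.

Definition directed (D : set L) : Prop :=
  D !=set0 /\
  forall x y, D x -> D y -> exists2 z, D z & (x <= z)%O /\ (y <= z)%O.

Definition compact_elt (c : L) : Prop :=
  forall (D : set L) (s : L), directed D -> supremums D s -> (c <= s)%O ->
    exists2 x, D x & (c <= x)%O.

(* [infimums S x] says that [x] is the infimum of [S] (unique by antisymmetry).
   Below, [L] is always complete, so infima and suprema of its subsets exist;
   [S = set0] gives preservation of the top element. *)
Definition preserves_infima (f : L -> M) : Prop :=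
  forall (S : set L) (x : L), infimums S x -> infimums (f @` S) (f x).

Definition preserves_directed_suprema (f : L -> M) : Prop :=
  forall (D : set L) (x : L), directed D -> supremums D x ->
    supremums (f @` D) (f x).

End Posets.

HB.mixin Record isAlgLattice (d : Order.disp_t) T of Order.POrder d T := {
  al_complete : forall S : set T, exists x : T, supremums S x;
  al_algebraic : forall x : T,
    exists2 K : set T, (forall c, K c -> compact_elt c) & supremums K x
}.

#[short(type="algLatticeType")]
HB.structure Definition AlgLattice (d : Order.disp_t) :=
  { T of isAlgLattice d T & Order.POrder d T }.

Record al_hom (d d' : Order.disp_t)
  (L : algLatticeType d) (M : algLatticeType d') := ALHom {
  al_fun :> L -> M;
  al_fun_inf : preserves_infima al_fun;
  al_fun_dsup : preserves_directed_suprema al_fun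
}.

Record str_functor (Sg : signature) (d : Order.disp_t) := StrFunctor {
  G_obj :> sigma_str Sg -> algLatticeType d;
  G_mor : forall A B : sigma_str Sg, hom A B -> al_hom (G_obj B) (G_obj A);
  G_id : forall A : sigma_str Sg, G_mor (hom_id A) =1 id;
  G_comp : forall (A B C : sigma_str Sg) (g : hom B C) (f : hom A B),
    G_mor (hom_comp g f) =1 G_mor f \o G_mor g
}.

(* On [set A] the order is the one of [SetOrder], i.e. inclusion. *)
Record filter_pair (Sg : signature) (d : Order.disp_t) := FilterPair {
  fp_G :> str_functor Sg d;
  fp_i : forall A : sigma_str Sg, fp_G A -> set A;
  fp_i_inf : forall A : sigma_str Sg, preserves_infima (@fp_i A);
  fp_i_dsup : forall A : sigma_str Sg, preserves_directed_suprema (@fp_i A);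
  fp_i_nat : forall (A B : sigma_str Sg) (h : hom A B) (b : fp_G B),
    fp_i (G_mor fp_G h b) = h @^-1` fp_i b
}.

Record tarskian (Sg : signature) (A : sigma_str Sg)
  (R : set A -> A -> Prop) : Prop := Tarskian {
  tarskian_refl : forall (Gamma : set A) (phi : A), Gamma phi -> R Gamma phi;
  tarskian_cut : forall (Gamma Delta : set A) (phi : A),
    R Gamma phi -> (forall psi, Gamma psi -> R Delta psi) -> R Delta phi;
  tarskian_mono : forall (Gamma Delta : set A) (phi : A),
    Gamma `<=` Delta -> R Gamma phi -> R Delta phi;
  tarskian_finitary : forall (Gamma : set A) (phi : A), R Gamma phi ->
    exists Delta : set A,
      [/\ finite_set Delta, Delta `<=` Gamma & R Delta phi];
  tarskian_struct : forall (Gamma : set A) (phi : A) (sigma : hom A A),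
    R Gamma phi -> R (sigma @` Gamma) (sigma phi)
}.

Definition fp_entails (Sg : signature) (d : Order.disp_t)
  (F : filter_pair Sg d) (A : sigma_str Sg) (Gamma : set A) (phi : A) : Prop :=
  forall a : F A, Gamma `<=` fp_i a -> fp_i a phi.

(* Main.v *)
(** Structurality is naturality of [i] at an endomorphism. Finitarity comes from
    directed suprema: for [D] a finite subset of [Gamma], let [c D] be the
    infimum of [{a | D `<=` i a}], so that [i (c D)] is the set of consequences
    of [D]. These [c D] form a directed family; if [s] is its supremum then
    [i s] is the union of the [i (c D)], hence contains [Gamma], hence every
    consequence of [Gamma]. *)

Require Import Defs.
From mathcomp Require Import all_boot all_order.
From mathcomp Require Import boolp classical_sets functions cardinality.

Local Open Scope classical_set_scope.

(** The supremum of the lower bounds of [S] is itself a lower bound. *)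
Lemma al_infimum_exists {d : Order.disp_t} {L : algLatticeType d} (S : set L) :
  exists x : L, infimums S x.
Proof.
have [x [xub xleast]] := al_complete (lbound S).
by exists x; split => [y Sy|y]; [apply: xleast => z; apply | apply: xub].
Qed.

Lemma infimums_setP {T : Type} {S : set (set T)} {X : set T} :
  infimums S X -> forall t, X t <-> forall Y, S Y -> Y t.
Proof.
move=> [Xlb Xglb] t; split => [Xt Y SY|SYt].
  by have /subsetPset := Xlb _ SY; apply.
have /Xglb /subsetPset : lbound S [set u | forall Y, S Y -> Y u].
  by move=> Y SY; apply/subsetPset => u; apply.
exact.
Qed.

Lemma supremums_setP {T : Type} {S : set (set T)} {X : set T} :
  supremums S X -> forall t, X t <-> exists2 Y, S Y & Y t.
Proof.
move=> [Xub Xlub] t; split => [|[Y SY]]; last first.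
  by have /subsetPset := Xub _ SY; apply.
have /Xlub /subsetPset : ubound S [set u | exists2 Y, S Y & Y u].
  by move=> Y SY; apply/subsetPset => u Yu; exists Y.
exact.
Qed.

Section FilterPair.
Context (Sg : signature) (d : Order.disp_t) (F : filter_pair Sg d).
Context (A : sigma_str Sg).
Implicit Types (D Gamma : set A) (c : F A).

(** A relation rather than a function of [D], since infima in [F A] are given by existence only. *)
Definition generates D c : Prop := infimums [set a : F A | D `<=` fp_i a] c.

(** As [fp_i] preserves infima, [fp_i c] is the intersection of all [fp_i a] containing [D]. *)
Lemma generates_entails {D c} : generates D c ->
  forall phi, fp_i c phi <-> fp_entails F D phi.
Proof.
move=> /fp_i_inf gc phi; have ic := infimums_setP gc; split => [/ic cphi a Da|Dphi].
  by apply: cphi; exists a.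
by apply/ic => _ [a Da <-]; apply: Dphi.
Qed.

Lemma generates_le {D D' c c'} : D `<=` D' -> generates D c ->
  generates D' c' -> (c <= c')%O.
Proof.
move=> DD' [cmin _] [_ c'max]; apply: c'max => a D'a.
exact: cmin (subset_trans DD' D'a).
Qed.

Lemma directed_finitely_generated Gamma :
  directed [set c | exists D,
    [/\ finite_set D, D `<=` Gamma & generates D c]].
Proof.
split => [|x y [D [finD DG gx]] [E [finE EG gy]]].
  (* The empty subset of [Gamma] gives a member; below, [D] and [E] are bounded through their
     union. *)
  have [c gc] := al_infimum_exists [set a : F A | set0 `<=` fp_i a].
  by exists c, set0; split; [exact: finite_set0 | exact: sub0set |].
have [z gz] := al_infimum_exists [set a : F A | (D `|` E) `<=` fp_i a].
exists z.
  by exists (D `|` E); split => //; [rewrite finite_setU | rewrite subUset].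
by split; [exact: (generates_le (@subsetUl _ D E) gx gz)
  | exact: (generates_le (@subsetUr _ D E) gy gz)].
Qed.

Lemma fp_entails_finitary Gamma phi : fp_entails F Gamma phi ->
  exists D, [/\ finite_set D, D `<=` Gamma & fp_entails F D phi].
Proof.
move=> Gphi; have dirG := directed_finitely_generated Gamma.
have [s sup_s] := al_complete [set c | exists D,
  [/\ finite_set D, D `<=` Gamma & generates D c]].
have is_ := supremums_setP (fp_i_dsup dirG sup_s).
(* Each [psi] in [Gamma] lies in the filter generated by [[set psi]], so [Gphi] applies to [s]; the
   union then puts [phi] in a single [fp_i c]. *)
have /Gphi /is_ [_ [c [D [finD DG gc]] <-] cphi] : Gamma `<=` fp_i s.
  move=> psi Gpsi; apply/is_.
  have [c gc] := al_infimum_exists [set a : F A | [set psi] `<=` fp_i a].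
  exists (fp_i c); last by apply/(generates_entails gc) => a; apply.
  exists c => //; exists [set psi]; split => //.
  by move=> _ ->.
by exists D; split => //; apply/(generates_entails gc).
Qed.

End FilterPair.

Theorem proposition2p3 (Sg : signature) (d : Order.disp_t)
  (F : filter_pair Sg d) (A : sigma_str Sg) :
  tarskian (fp_entails F (A := A)).
Proof.
split.
- by move=> Gamma phi Gphi a; apply.
- by move=> Gamma Delta phi Gphi DG a Da; apply: Gphi => psi /DG; apply.
- by move=> Gamma Delta phi GD Gphi a /(subset_trans GD); apply: Gphi.
- exact: fp_entails_finitary.
- move=> Gamma phi sigma Gphi a sGa.
  (* Pulling [a] back along [sigma] gives an element of [F A] to which [Gphi] applies. *)
  have : fp_i (G_mor F sigma a) phi.
    apply: Gphi; rewrite fp_i_nat => psi Gpsi.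
    by apply: sGa; exists psi.
  by rewrite fp_i_nat.
Qed.
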